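(* Assume the setting described in the context. The transvectants $(\alpha^{\mathbf k},\beta^{\boldsymbol\ell})^{(s)}$ with $\mathbf k\in\acute A$, $\boldsymbol\ell\in\grave A$, $0\le s\le\widehat\alpha\mathbf k$, $0\le s\le\widehat\beta\boldsymbol\ell$ (the admissible transvectants) form a vector space basis of the polynomial invariants $\mathcal J\cap\mathbb R[\mathbf x,\mathbf y]$, and a formal vector space basis of $\mathcal J$ (they are linearly independent and every element of $\mathcal J$ is a countable linear combination of them).
   Context: For a real square matrix $A_0$ and a formal power series $f$ put $\mathcal D_{A_0}f(\mathbf x)=f'(\mathbf x)A_0\mathbf x$. Let $(\acute X,\acute Y,\acute Z)$, $(\grave X,\grave Y,\grave Z)$ be $\mathfrak{sl}_2$ triads ($[X,Y]=Z,[Z,X]=2X,[Z,Y]=-2Y$) of real $n\times n$ resp. $m\times m$ matrices, with variables $\mathbf x\in\mathbb R^n$, $\mathbf y\in\mathbb R^m$ (independent). On $\mathbb R[[\mathbf x]]$: $\acute{\mathcal X}=\mathcal D_{\acute Y},\acute{\mathcal Y}=\mathcal D_{\acute X},\acute{\mathcal Z}=\mathcal D_{\acute Z}$; on $\mathbb R[[\mathbf y]]$ analogously $\grave{\mathcal X},\grave{\mathcal Y},\grave{\mathcal Z}$; on $\mathbb R[[\mathbf x,\mathbf y]]$: $\mathcal X=\acute{\mathcal X}+\grave{\mathcal X}$. $\acute{\mathcal J}=\ker\acute{\mathcal X}$, $\grave{\mathcal J}=\ker\grave{\mathcal X}$, $\mathcal J=\ker\mathcal X$. A weight invariant of $\acute{\mathcal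 J}$ is $f\in\acute{\mathcal J}$ with $\acute{\mathcal Z}f=\widehat ff$ (similarly for $\grave{\mathcal J}$). $\alpha=(\alpha_1,\dots,\alpha_p)$ is a Hilbert basis of $\acute{\mathcal J}$: homogeneous weight invariants (weights $\widehat\alpha_i$) such that every element of $\acute{\mathcal J}$ is a countable linear combination of monomials $\alpha^{\mathbf k}$; $\widehat\alpha\mathbf k=\sum\widehat\alpha_ik_i$. Likewise $\beta=(\beta_1,\dots,\beta_q)$ for $\grave{\mathcal J}$. $\acute A\subset\mathbb N^p$ is a standard preferred set: the $\alpha^{\mathbf k}$, $\mathbf k\in\acute A$, are pairwise distinct, linearly independent and span $\acute{\mathcal J}$ by countable linear combinations, and $\acute A$ is closed under componentwise-smaller vectors; likewise $\grave A\subset\mathbb N^q$ for $\beta$. External transvectant: for weight invariants $f\in\acute{\mathcal J}$, $g\in\grave{\mathcal J}$, integer $0\le s\le\min(\widehat f,\widehat g)$: $(f,g)^{(s)}=\sum_{j=0}^s(-1)^j\binom sj\frac{(\widehat f-j)!}{(\widehat f-s)!}\frac{(\widehat g-s+j)!}{(\widehat g-s)!}(\acute{\mathcal Y}^jf)(\grave{\mathcal Y}^{s-j}g)$. The weight of $\alpha^{\mathbf k}$ is $\widehat\alpha\mathbf k$. *)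

(* Defs.v *)
From HB Require Import structures.
From mathcomp Require Import all_boot all_order all_algebra.
From mathcomp Require Import reals.
From mathcomp.multinomials Require Import mpoly.

Set Implicit Arguments.
Unset Strict Implicit.
Unset Printing Implicit Defensive.

Import Order.TTheory GRing.Theory Num.Theory.
Local Open Scope ring_scope.

(* Formal power series in n variables, represented by their sequence of
   homogeneous components: f d is the homogeneous part of degree d.     *)
Section FPS.
Variable R : fieldType.

Definition fps (n : nat) := nat -> {mpoly R[n]}.

Definition is_fps n (f : fps n) : Prop := forall d, f d \is d.-homog.

Definition fps_homog n (f : fps n) (e : nat) : Prop :=
  is_fps f /\ forall d, d <> e -> f d = 0.

Definition is_poly_fps n (f : fps n) : Prop :=
  exists D : nat, forall d, (D < d)%N -> f d = 0.

Definition fps0 n : fps n := fun _ => 0.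
Definition fps1 n : fps n := fun d => if d == 0%N then 1 else 0.
Definition fps_scale n (c : R) (f : fps n) : fps n := fun d => c *: f d.
Definition fps_mul n (f g : fps n) : fps n :=
  fun d => \sum_(i < d.+1) f i * g (d - i)%N.
Definition fps_exp n (f : fps n) (k : nat) : fps n := iter k (fps_mul f) (fps1 n).

Definition fps_monom n p (a : 'I_p -> fps n) (k : {ffun 'I_p -> nat}) : fps n :=
  \big[@fps_mul n / fps1 n]_(i < p) fps_exp (a i) (k i).

Definition wdot p (w : 'I_p -> nat) (k : {ffun 'I_p -> nat}) : nat :=
  (\sum_(i < p) w i * k i)%N.

Definition Dpoly n (A : 'M[R]_n) (P : {mpoly R[n]}) : {mpoly R[n]} :=
  \sum_(i < n) mderiv i P * (\sum_(j < n) A i j *: 'X_j).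
Definition fpsD n (A : 'M[R]_n) (f : fps n) : fps n := fun d => Dpoly A (f d).

Definition embl n m (f : fps n) : fps (n + m) :=
  fun d => f d \mPo [tuple 'X_(lshift m i) | i < n].
Definition embr n m (g : fps m) : fps (n + m) :=
  fun d => g d \mPo [tuple 'X_(rshift n i) | i < m].

Definition lie n (A B : 'M[R]_n) := A *m B - B *m A.
Definition sl2_triad n (X Y Z : 'M[R]_n) : Prop :=
  [/\ lie X Y = Z, lie Z X = 2 *: X & lie Z Y = - (2 *: Y)].

(* kernel of the operator  calX = D_Y  (Y the second matrix of the triad) *)
Definition in_J n (Y : 'M[R]_n) (f : fps n) : Prop :=
  is_fps f /\ fpsD Y f = fps0 n.

Definition weight_inv n (Y Z : 'M[R]_n) (w : nat) (f : fps n) : Prop :=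
  in_J Y f /\ fpsD Z f = fps_scale w%:R f.

Definition fin_lincomb n (T : eqType) (P : pred T) (F : T -> fps n) (f : fps n) : Prop :=
  exists (s : seq T) (c : T -> R),
    (forall t, t \in s -> P t) /\ forall d, f d = \sum_(t <- s) c t *: F t d.

Definition lin_indep n (T : eqType) (P : pred T) (F : T -> fps n) : Prop :=
  forall (s : seq T) (c : T -> R), uniq s -> (forall t, t \in s -> P t) ->
    (forall d, \sum_(t <- s) c t *: F t d = 0) -> forall t, t \in s -> c t = 0.

Definition countable_lincomb n (T : eqType) (P : pred T) (F : T -> fps n) (f : fps n) : Prop :=
  exists c : T -> R, (forall t, ~~ P t -> c t = 0) /\
    forall d, exists s : seq T,
      [/\ uniq s, (forall t, c t *: F t d != 0 -> t \in s)
        & f d = \sum_(t <- s) c t *: F t d].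

Definition hilbert_basis n p (Y Z : 'M[R]_n) (alpha : 'I_p -> fps n) (w : 'I_p -> nat) : Prop :=
  [/\ forall i, exists e, fps_homog (alpha i) e,
      forall i, weight_inv Y Z (w i) (alpha i)
    & forall f, in_J Y f -> countable_lincomb predT (fps_monom alpha) f].

Definition std_preferred_set n p (Y : 'M[R]_n) (alpha : 'I_p -> fps n)
    (A : pred {ffun 'I_p -> nat}) : Prop :=
  [/\ forall k k', A k -> A k' -> fps_monom alpha k = fps_monom alpha k' -> k = k',
      lin_indep A (fps_monom alpha),
      forall f, in_J Y f -> countable_lincomb A (fps_monom alpha) f
    & forall k k' : {ffun 'I_p -> nat}, A k -> (forall i, (k' i <= k i)%N) -> A k'].

Definition transvectant n m (X1 : 'M[R]_n) (X2 : 'M[R]_m) (f : fps n) (g : fps m)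
    (wf wg s : nat) : fps (n + m) :=
  fun d => \sum_(j < s.+1)
    ((-1) ^+ j * 'C(s, j)%:R * ((wf - j)`!%:R / (wf - s)`!%:R)
       * ((wg - s + j)`!%:R / (wg - s)`!%:R))
    *: fps_mul (embl m (iter j (fpsD X1) f)) (embr n (iter (s - j) (fpsD X2) g)) d.

Definition tv_index (p q : nat) := ({ffun 'I_p -> nat} * {ffun 'I_q -> nat} * nat)%type.

Definition admissible p q (wa : 'I_p -> nat) (wb : 'I_q -> nat)
    (A1 : pred {ffun 'I_p -> nat}) (A2 : pred {ffun 'I_q -> nat}) : pred (tv_index p q) :=
  fun t => [&& A1 t.1.1, A2 t.1.2, (t.2 <= wdot wa t.1.1)%N & (t.2 <= wdot wb t.1.2)%N].

Definition tv n m p q (X1 : 'M[R]_n) (X2 : 'M[R]_m)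
    (alpha : 'I_p -> fps n) (wa : 'I_p -> nat) (beta : 'I_q -> fps m) (wb : 'I_q -> nat)
    (t : tv_index p q) : fps (n + m) :=
  transvectant X1 X2 (fps_monom alpha t.1.1) (fps_monom beta t.1.2)
    (wdot wa t.1.1) (wdot wb t.1.2) t.2.

End FPS.

(* Main.v *)
Require Import Defs.
From HB Require Import structures.
From mathcomp Require Import all_boot all_order all_algebra.
From mathcomp Require Import reals boolp.
From mathcomp.multinomials Require Import mpoly.
From mathcomp Require Import ring zify.

(* Let [a_k] be the given weight basis of [ker calX] in one block of variables.
   The operators are locally nilpotent, since [X] and [Y] are eigenvectors of
   [ad Z]; this forces the vectors [calY^j a_k], [j <= w_k], to be a basis of
   the polynomial ring, and those with [j < N] to be a basis of [ker calX^N].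
   Expanding [f] as a sum of [calY^j a_k (x) g_(k,j)], the equation [calX f = 0]
   says that [f] is determined by the [g_(k,0)], which may be arbitrary elements
   of the kernel of [calX^(w_k + 1)] in the other block.  That kernel has the
   basis [calY^s b_l] with [s <= w_k] and [s <= w_l], and the invariant with
   leading term [a_k (x) calY^s b_l] is, up to a nonzero factor, the transvectant
   of [a_k] and [b_l] of order [s].  Everything is graded by the degree, so
   formal power series reduce to polynomials. *)

Set Implicit Arguments.
Unset Strict Implicit.
Unset Printing Implicit Defensive.

Import Order.TTheory GRing.Theory Num.Theory.
Local Open Scope ring_scope.

(** * Modules over sl2 *)

Section SumWiden.
Variables (T : eqType) (V W : nmodType) (G : T -> W -> V).
Hypotheses (G0 : forall t, G t 0 = 0) (GD : forall t x y, G t (x + y) = G t x + G t y).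
Implicit Types (s u : seq T) (g h : T -> W).

(** Padding with zero coefficients brings two expansions to a common index sequence. *)
Lemma sum_widen s u g : uniq s -> uniq u -> {subset s <= u} ->
  \sum_(t <- s) G t (g t) = \sum_(t <- u) G t (if t \in s then g t else 0).
Proof.
move=> us uu su; transitivity (\sum_(t <- u | t \in s) G t (g t)).
  rewrite -[RHS]big_filter; apply: perm_big; apply: uniq_perm => //.
    exact: filter_uniq.
  by move=> t; rewrite mem_filter andb_idr // => /su.
by rewrite big_mkcond; apply: eq_bigr => t _; case: ifP.
Qed.

(** The coefficients lie in any additive monoid [W]: scalars for ordinary spans, polynomials in the
    second block of variables for tensors. *)
Definition expands (P : pred T) (x : V) : Prop :=
  exists (s : seq T) (g : T -> W),
    [/\ uniq s, {in s, forall t, P t} & x = \sum_(t <- s) G t (g t)].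

Lemma expands0 P : expands P 0.
Proof. by exists [::], (fun=> 0); rewrite big_nil. Qed.

Lemma expandsD P x y : expands P x -> expands P y -> expands P (x + y).
Proof.
move=> [s [g [us sP ->]]] [u [h [uu uP ->]]].
exists (undup (s ++ u)),
  (fun t => (if t \in s then g t else 0) + (if t \in u then h t else 0)).
split; first exact: undup_uniq.
  by move=> t; rewrite mem_undup mem_cat => /orP[/sP|/uP].
rewrite (eq_bigr _ (fun t _ => GD t _ _)) big_split.
by congr (_ + _); apply: sum_widen; rewrite ?undup_uniq // => t;
  rewrite mem_undup mem_cat => ->; rewrite ?orbT.
Qed.

End SumWiden.

(** * Spans and independence of families *)

Section Span.
Variables (F : fieldType) (V : lmodType F).

Definition spanned (T : eqType) (P : pred T) (v : T -> V) (x : V) : Prop :=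
  expands (fun t (c : F) => c *: v t) P x.

Definition independent (T : eqType) (P : pred T) (v : T -> V) : Prop :=
  forall (s : seq T) (c : T -> F), uniq s -> {in s, forall t, P t} ->
    \sum_(t <- s) c t *: v t = 0 -> {in s, forall t, c t = 0}.

Section OneFamily.
Variables (T : eqType) (P : pred T) (v : T -> V).

Lemma spanned0 : spanned P v 0.
Proof. exact: expands0. Qed.

Lemma spannedZ c x : spanned P v x -> spanned P v (c *: x).
Proof.
move=> [s [d [us sP ->]]]; exists s, (fun t => c * d t); split=> //.
by rewrite scaler_sumr; apply: eq_bigr => t _; rewrite scalerA.
Qed.

Lemma spanned_gen t : P t -> spanned P v (v t).
Proof.
move=> Pt; exists [:: t], (fun=> 1); split=> //.
  by move=> u; rewrite inE => /eqP ->.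
by rewrite big_seq1 scale1r.
Qed.

Lemma spannedD x y : spanned P v x -> spanned P v y -> spanned P v (x + y).
Proof. by apply: expandsD => t *; rewrite ?scale0r ?scalerDl. Qed.

Lemma spanned_sum (I : Type) (r : seq I) (Q : pred I) (x : I -> V) :
  (forall i, Q i -> spanned P v (x i)) -> spanned P v (\sum_(i <- r | Q i) x i).
Proof. by move=> Px; elim/big_rec: _ => [|i y Qi ?]; [exact: spanned0|apply: spannedD; auto]. Qed.

End OneFamily.

Lemma spanned_trans (T U : eqType) (P : pred T) (Q : pred U) v v' x :
  {in P, forall t, spanned Q v' (v t)} -> spanned P v x -> spanned Q v' x.
Proof.
move=> PQ [s [c [us sP ->]]]; rewrite big_seq; apply: spanned_sum => t ts.
by apply: spannedZ; apply: PQ; apply: sP.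
Qed.

End Span.

Lemma spanned_linear (F : fieldType) (V W : lmodType F) (f : {linear V -> W})
    (T : eqType) (P : pred T) (v : T -> V) x :
  spanned P v x -> spanned P (f \o v) (f x).
Proof.
move=> [s [c [us sP ->]]]; exists s, c; split=> //.
by rewrite linear_sum; apply: eq_bigr => t _; rewrite linearZ.
Qed.

Section IterLinear.
Variables (F : fieldType) (V : lmodType F) (f : {linear V -> V}).

Fact iter_is_linear j : linear (iter j f).
Proof. by elim: j => [|j IH] c x y //=; rewrite IH linearP. Qed.

HB.instance Definition _ j := GRing.isLinear.Build F V V _ (iter j f) (iter_is_linear j).

Lemma iter_add j x y : iter j f (x + y) = iter j f x + iter j f y.
Proof. exact: linearD. Qed.

Lemma iterB j x y : iter j f (x - y) = iter j f x - iter j f y.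
Proof. exact: linearB. Qed.

Lemma iterZ j c x : iter j f (c *: x) = c *: iter j f x.
Proof. exact: linearZ. Qed.

Lemma iter_sum j (I : Type) (r : seq I) (P : pred I) (x : I -> V) :
  iter j f (\sum_(i <- r | P i) x i) = \sum_(i <- r | P i) iter j f (x i).
Proof. exact: linear_sum. Qed.

Lemma iter_eq0_leq i j x : (i <= j)%N -> iter i f x = 0 -> iter j f x = 0.
Proof. by move=> /subnK <- x0; rewrite iterD x0 linear0. Qed.

End IterLinear.

(** * Ladders descending from highest weight vectors *)

Section Sl2.
Variables (F : numFieldType) (V : lmodType F) (X Y Z : {linear V -> V}).
Hypothesis XY : forall v, X (Y v) = Y (X v) + Z v.
Hypothesis ZX : forall v, Z (X v) = X (Z v) + 2 *: X v.
Hypothesis ZY : forall v, Z (Y v) = Y (Z v) - 2 *: Y v.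

Section HighestWeight.
Variables (a : V) (w : nat).
Hypotheses (Xa : X a = 0) (Za : Z a = w%:R *: a).

Lemma Z_iterY j : Z (iter j Y a) = (w%:R - j.*2%:R) *: iter j Y a.
Proof.
elim: j => [|j IH]; first by rewrite double0 subr0 Za.
rewrite iterS ZY IH linearZ /= -scalerBl; congr (_ *: _).
by rewrite -!muln2; ring.
Qed.

(** Each exchange of [X] with a [Y] contributes a [Z]-eigenvalue; the factor is the sum of w, w - 2,
    ..., w - 2j. *)
Lemma X_iterY j : X (iter j.+1 Y a) = (j.+1%:R * (w%:R - j%:R)) *: iter j Y a.
Proof.
elim: j => [|j IH]; first by rewrite /= XY Xa linear0 add0r Za subr0 mul1r.
rewrite iterS XY IH Z_iterY linearZ /= -scalerDl; congr (_ *: _).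
by rewrite -!muln2; ring.
Qed.

(** The factors of [X_iterY] multiply up to falling factorials of naturals, a form in which the
    coefficient is visibly nonzero. *)
Lemma iterX_iterY i s : (i <= s)%N -> (s <= w)%N ->
  iter i X (iter s Y a) = (s ^_ i * (w - s + i) ^_ i)%:R *: iter (s - i) Y a.
Proof.
move=> + sw; elim: i => [|i IH] le_is.
  by rewrite !ffactn0 subn0 scale1r.
rewrite iterS IH ?(ltnW le_is) // linearZ /=.
have -> : (s - i = (s - i.+1).+1)%N by lia.
rewrite X_iterY scalerA; congr (_ *: _).
rewrite ffactnSr addnS ffactnS /=.
have -> : (s - i.+1).+1 = (s - i)%N by lia.
have -> : (w%:R - (s - i.+1)%:R : F) = (w - s + i).+1%:R.
  by rewrite -natrB ?(leq_trans (leq_subr _ _) sw) //; congr _%:R; lia.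
by rewrite !natrM; ring.
Qed.

Lemma iterX_iterY0 i j : (j < i)%N -> iter i X (iter j Y a) = 0.
Proof.
move=> ji; apply: (iter_eq0_leq ji) => {ji}.
elim: j => [|j IH] /=; first exact: Xa.
by rewrite -iterS iterSr -iterS X_iterY linearZ /= -iterS IH scaler0.
Qed.

End HighestWeight.

(** Commuting [Y] past each of the N+1 copies of [X] leaves one [Z]; moving these to the left shifts
    them by 0, -2, ..., -2N, on average by -N. *)
Lemma iterXY N v : iter N.+1 X (Y v) =
  Y (iter N.+1 X v) + N.+1%:R *: (Z (iter N X v) - N%:R *: iter N X v).
Proof.
elim: N => [|N IH]; first by rewrite /= XY scale0r subr0 scale1r.
rewrite iterS IH linearD linearZ linearB linearZ /= XY.
have -> : X (Z (iter N X v)) = Z (X (iter N X v)) - 2 *: X (iter N X v).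
  by rewrite ZX addrK.
rewrite -!iterS -addrA; congr (_ + _).
rewrite !scalerBr !scalerA addrA [in RHS]mulrSr.
rewrite -[Z _ in LHS]scale1r scalerDl !scale1r [X in _ = X - _]addrC -!addrA.
congr (_ + (_ + _)); rewrite -!scaleNr -scalerDl; congr (_ *: _).
by ring.
Qed.

Section Basis.
Variables (K : eqType) (A : pred K) (a : K -> V) (w : K -> nat).
Hypothesis aX : {in A, forall k, X (a k) = 0}.
Hypothesis aZ : {in A, forall k, Z (a k) = (w k)%:R *: a k}.
Hypothesis a_free : independent A a.
Hypothesis a_span : forall v, X v = 0 -> spanned A a v.
Hypothesis nilpY : forall v, exists N, iter N Y v = 0.
Hypothesis nilpX : forall v, exists N, iter N X v = 0.

(* [X^(N+M) Y^M v] is computed from [X^N v] alone, without decomposing [v]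
   into weight vectors; since [Y^M v = 0] for large [M], it bounds the weights
   of [X^N v] from below by [N]. *)
Lemma iterX_iterY_top (s : seq K) (c : K -> F) N M v : {in s, forall k, A k} ->
  iter N X v = \sum_(k <- s) c k *: a k ->
  iter (N + M) X (iter M Y v) = \sum_(k <- s)
    (c k * \prod_(i < M) ((N + i).+1%:R * ((w k)%:R - (N + i)%:R))) *: a k.
Proof.
move=> sA vE; elim: M => [|M IH].
  by rewrite addn0 vE; apply: eq_bigr => k _; rewrite big_ord0 mulr1.
pose d k := c k * \prod_(i < M) ((N + i).+1%:R * ((w k)%:R - (N + i)%:R)).
rewrite addnS [iter M.+1 Y v]iterS iterXY iterS IH -/d.
have -> : X (\sum_(k <- s) d k *: a k) = 0.
  by rewrite linear_sum big_seq big1 // => k /sA kA; rewrite linearZ /= aX ?scaler0.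
rewrite -/(\sum_(k <- s) d k *: a k) linear0 add0r linear_sum scaler_sumr -sumrB scaler_sumr.
rewrite big_seq [RHS]big_seq; apply: eq_bigr => k /sA kA.
rewrite linearZ /= aZ // !scalerA -scalerBl scalerA big_ord_recr /= /d.
by congr (_ *: _); ring.
Qed.

Definition ladder (t : K * nat) := iter t.2 Y (a t.1).
Definition ladder_dom : pred (K * nat) := fun t => A t.1 && (t.2 <= w t.1)%N.

(** By induction on N: if [X] to the power N+1 kills v, then [iter N X v] is a combination of the
    [a k], and subtracting a combination of rungs at height N with the same image leaves a vector
    killed by [iter N X]. *)
Lemma spanned_ker_iterX N v : iter N X v = 0 ->
  spanned (fun t => ladder_dom t && (t.2 < N)%N) ladder v.
Proof.
elim: N v => [|N IH] v vN; first by rewrite -[v]/(iter 0 X v) vN; apply: spanned0.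
have [s [c [us sA vE]]] : spanned A a (iter N X v) by apply: a_span; rewrite -iterS.
(* Once [iter M Y v] is 0, [iterX_iterY_top] and independence make [c k] times a product vanish; no
   factor of the product is zero when [w k < N]. *)
have c0 k : k \in s -> (w k < N)%N -> c k = 0.
  move=> ks wN; have [M YM] := nilpY v.
  have /esym := iterX_iterY_top M sA vE; rewrite YM linear0 => /(a_free us sA)/(_ k ks)/eqP.
  rewrite mulf_eq0 => /orP[/eqP//|/prodf_eq0[i _]].
  rewrite mulf_eq0 pnatr_eq0 subr_eq0 eqr_nat /= => /eqP; lia.
(* The denominator is the factor by which [iter N X] returns rung N to [a k]. It is zero exactly
   when [w k < N], where [c k] is already zero. *)
pose y := \sum_(k <- s) (c k / (N`! * w k ^_ N)%:R) *: iter N Y (a k).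
have yX : iter N X y = iter N X v.
  rewrite iter_sum vE big_seq [RHS]big_seq; apply: eq_bigr => k ks; rewrite iterZ.
  have [wN|Nw] := ltnP (w k) N; first by rewrite c0 // mul0r !scale0r.
  rewrite (iterX_iterY (aX (sA _ ks)) (aZ (sA _ ks))) // scalerA ffactnn subnK // subnn.
  by rewrite divfK // pnatr_eq0 -lt0n muln_gt0 fact_gt0 ffact_gt0.
rewrite -[v](subrK y); apply: spannedD.
  apply: (@spanned_trans _ _ _ _ (fun t => ladder_dom t && (t.2 < N)%N) _ ladder).
    move=> t /andP[dt tN]; apply: spanned_gen; rewrite /= dt /=; exact: ltnW.
  by apply: IH; rewrite iterB yX subrr.
rewrite /y big_seq; apply: spanned_sum => k ks.
have [wN|Nw] := ltnP (w k) N; first by rewrite c0 // mul0r scale0r; apply: spanned0.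
apply: spannedZ; apply: (@spanned_gen _ _ _ _ ladder (k, N)).
by rewrite /ladder_dom /= sA // Nw leqnn.
Qed.

Lemma spanned_ladder v : spanned ladder_dom ladder v.
Proof.
have [N vN] := nilpX v; apply: spanned_trans (spanned_ker_iterX vN).
by move=> t /andP[dt _]; apply: spanned_gen.
Qed.

(** Coefficients are eliminated from the highest rung downwards: [iter N X] kills the rungs below N
    and sends rung N over k to a nonzero multiple of [a k], so independence of [a] applies. *)
Lemma ladder_independent : independent ladder_dom ladder.
Proof.
move=> s c us sP s0.
suff H N : {in s, forall t, (N <= t.2)%N -> c t = 0} -> {in s, forall t, c t = 0}.
  apply: (H (\max_(t <- s) t.2).+1) => t ts.
  by rewrite ltnNge leq_bigmax_seq.
elim: N => [|N IH] cN; first by move=> t ts; apply: cN.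
apply: IH => t ts; rewrite leq_eqVlt => /orP[/eqP tN|]; last exact: cN.
pose u := [seq x <- s | x.2 == N].
have uE x : x \in u -> [/\ x \in s, A x.1, (N <= w x.1)%N & x = (x.1, N)].
  rewrite mem_filter => /andP[/eqP xN xs]; have /andP[Ax wx] := sP _ xs.
  by split=> //; [rewrite -xN|rewrite -xN -surjective_pairing].
have u_uniq : uniq [seq x.1 | x <- u].
  rewrite map_inj_in_uniq ?filter_uniq // => x y /uE[_ _ _ ->] /uE[_ _ _ ->] /= -> //.
have uA : {in [seq x.1 | x <- u], forall k, A k}.
  by move=> k /mapP[x /uE[_ ? _ _] ->].
have tu : t \in u by rewrite mem_filter tN eqxx.
suff u0 : \sum_(k <- [seq x.1 | x <- u]) (c (k, N) * (N`! * w k ^_ N)%:R) *: a k = 0.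
  have [_ _ Nw tE] := uE _ tu.
  have /eqP := a_free u_uniq uA u0 (map_f _ tu).
  have /negPf nz : (N`! * w t.1 ^_ N)%:R != 0 :> F.
    by rewrite pnatr_eq0 -lt0n muln_gt0 fact_gt0 ffact_gt0.
  by rewrite mulf_eq0 nz orbF -tE => /eqP.
transitivity (iter N X (\sum_(t <- s) c t *: ladder t)); last by rewrite s0 linear0.
rewrite big_map iter_sum [RHS](bigID (fun x => x.2 == N)) /=.
rewrite [X in _ = _ + X]big_seq_cond [X in _ = _ + X]big1 ?addr0; last first.
  move=> x /andP[xs /= xN]; have /andP[Ax wx] := sP _ xs.
  have [lt_xN|lt_Nx|eq_xN] := ltngtP x.2 N; last by rewrite eq_xN eqxx in xN.
    by rewrite iterZ (iterX_iterY0 (aX Ax) (aZ Ax)) ?scaler0.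
  by rewrite cN // scale0r linear0.
rewrite -[RHS]big_filter -/u big_seq [RHS]big_seq.
apply: eq_bigr => x /uE[_ Ax Nw xE].
rewrite iterZ /ladder xE /=.
by rewrite (iterX_iterY (aX Ax) (aZ Ax)) // ffactnn subnK // subnn scalerA.
Qed.

End Basis.
End Sl2.

(** * Linear vector fields acting on polynomials *)

(** Identities built from derivations and ring morphisms need then be checked only on constants and
    variables. *)
Lemma mpoly_ring_ind (R : comNzRingType) n (P : {mpoly R[n]} -> Prop) :
  (forall c, P c%:MP) -> (forall i, P 'X_i) ->
  (forall p q, P p -> P q -> P (p + q)) ->
  (forall p q, P p -> P q -> P (p * q)) -> forall p, P p.
Proof.
move=> PC PX PD PM p; rewrite [p]mpolyE.
elim/big_ind: _ => [|x y Px Py|m _]; [by rewrite -mpolyC0|exact: PD|].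
rewrite -mul_mpolyC; apply: (PM) => //; rewrite mpolyXE_id.
elim/big_ind: _ => [|x y Px Py|i _]; [by rewrite -mpolyC1|exact: PM|].
elim: (m i) => [|k IH]; first by rewrite expr0 -mpolyC1.
by rewrite exprS; apply: PM.
Qed.

(* The powers of [B] are eigenvectors of [ad A] for the eigenvalues [k c],
   so only finitely many of them can be nonzero. *)
Lemma lie_eigen_nilpotent (R : numFieldType) n (A B : 'M[R]_n) (c : R) :
  c != 0 -> lie A B = c *: B -> exists k, iter k (mulmx B) 1%:M = 0.
Proof.
move=> c0 AB; pose Bk k := iter k (mulmx B) 1%:M.
have BkC k : Bk k *m B = B *m Bk k.
  by elim: k => [|k IH]; [rewrite /Bk mul1mx mulmx1|rewrite /= -mulmxA IH].
have ABk k : A *m Bk k - Bk k *m A = (k%:R * c) *: Bk k.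
  elim: k => [|k IH]; first by rewrite /Bk mulmx1 mul1mx subrr mul0r scale0r.
  have -> : A *m Bk k.+1 - Bk k.+1 *m A =
            lie A B *m Bk k + B *m (A *m Bk k - Bk k *m A).
    by rewrite [Bk k.+1]/(B *m Bk k) /lie mulmxBl mulmxBr !mulmxA addrA subrK.
  rewrite AB IH -scalemxAl -scalemxAr -scalerDl.
  by congr (_ *: _); rewrite -natr1 mulrDl mul1r addrC.
(* [g] is the matrix of ad A on vectorised matrices, of size n * n, so it has at most n * n
   eigenvalues. *)
pose g := lin_mulmx A - lin_mulmxr A.
have gE M : mxvec M *m g = mxvec (A *m M - M *m A).
  by rewrite mulmxBr !mul_vec_lin /= linearB.
pose N := (n * n)%N.
suff /existsP[k /eqP Bk0] : [exists k : 'I_N.+2, Bk k == 0] by exists k.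
apply: contraT; rewrite negb_exists => /forallP Bk_neq0.
(* If none of these powers of B vanished, the pairwise distinct k c would all be roots of the
   characteristic polynomial of [g]. *)
pose rs := [seq k%:R * c | k <- iota 0 N.+2].
suff : (size rs < size (char_poly g))%N.
  by rewrite size_map size_iota size_char_poly ltnNge ltnW.
apply: max_poly_roots.
- by rewrite -size_poly_eq0 size_char_poly.
- apply/allP => _ /mapP[k + ->]; rewrite mem_iota add0n => /= kN.
  rewrite -eigenvalue_root_char; apply/eigenvalueP; exists (mxvec (Bk k)).
    by rewrite gE ABk linearZ.
  by rewrite mxvec_eq0; have := Bk_neq0 (Ordinal kN).
- rewrite map_inj_uniq ?iota_uniq // => i j /(mulIf c0)/eqP.
  by rewrite eqr_nat => /eqP.
Qed.

Section Derivation.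
Variables (R : fieldType) (n : nat).
Implicit Types (A B : 'M[R]_n) (p q : {mpoly R[n]}).

Fact Dpoly_is_linear A : linear (Dpoly A).
Proof.
move=> c p q; rewrite /Dpoly scaler_sumr -big_split /=.
by apply: eq_bigr => i _; rewrite linearP mulrDl scalerAl.
Qed.

HB.instance Definition _ A := GRing.isLinear.Build R {mpoly R[n]} {mpoly R[n]} _
  (Dpoly A) (Dpoly_is_linear A).

Lemma DpolyM A p q : Dpoly A (p * q) = Dpoly A p * q + p * Dpoly A q.
Proof.
rewrite /Dpoly mulr_suml mulr_sumr -big_split /=; apply: eq_bigr => i _.
by rewrite mderivM; ring.
Qed.

Lemma DpolyC A c : Dpoly A c%:MP = 0.
Proof. by rewrite /Dpoly big1 // => i _; rewrite mderivC mul0r. Qed.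

Lemma DpolyX A i : Dpoly A 'X_i = \sum_j A i j *: 'X_j.
Proof.
rewrite /Dpoly (bigD1 i) //= [X in _ + X]big1 ?addr0 => [|j ji].
  by rewrite mderivX mnmE eqxx -{1}[U_(i)%MM]add0m addmK mpolyX0 mulr1n scale1r mul1r.
by rewrite mderivX mnmE eq_sym (negPf ji) scale0r mul0r.
Qed.

Lemma Dpoly_eigenM A a b p q : Dpoly A p = a *: p -> Dpoly A q = b *: q ->
  Dpoly A (p * q) = (a + b) *: (p * q).
Proof. by move=> pa qb; rewrite DpolyM pa qb scalerDl -scalerAl -scalerAr. Qed.

Lemma Dpoly_eigenX A a p k : Dpoly A p = a *: p ->
  Dpoly A (p ^+ k) = (a * k%:R) *: p ^+ k.
Proof.
move=> pa; elim: k => [|k IH]; first by rewrite mulr0 scale0r expr0 -mpolyC1 DpolyC.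
by rewrite exprS (Dpoly_eigenM pa IH) -natr1 mulrDr mulr1 addrC.
Qed.

Lemma Dpoly_eigen_prod A (I : Type) (r : seq I) (p : I -> {mpoly R[n]}) (a : I -> R) :
  (forall i, Dpoly A (p i) = a i *: p i) ->
  Dpoly A (\prod_(i <- r) p i) = (\sum_(i <- r) a i) *: \prod_(i <- r) p i.
Proof.
move=> pa; elim: r => [|i r IH]; first by rewrite !big_nil scale0r -mpolyC1 DpolyC.
by rewrite !big_cons (Dpoly_eigenM (pa i) IH).
Qed.

Lemma Dpoly_scale A c p : Dpoly (c *: A) p = c *: Dpoly A p.
Proof.
rewrite /Dpoly scaler_sumr; apply: eq_bigr => i _.
rewrite scalerAr scaler_sumr; congr (_ * _).
by apply: eq_bigr => j _; rewrite mxE scalerA.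
Qed.

(** A commutator of derivations is a derivation, so the variables decide; on them composing the
    fields multiplies the matrices in the opposite order. *)
Lemma Dpoly_lie A B p :
  Dpoly A (Dpoly B p) = Dpoly B (Dpoly A p) + Dpoly (lie B A) p.
Proof.
have DX (C D : 'M[R]_n) i : Dpoly C (Dpoly D 'X_i) = \sum_k (D *m C) i k *: 'X_k.
  rewrite DpolyX linear_sum /=.
  under eq_bigr => j _ do rewrite linearZ /= DpolyX scaler_sumr.
  rewrite exchange_big /=; apply: eq_bigr => k _.
  by rewrite mxE scaler_suml; apply: eq_bigr => j _; rewrite scalerA.
elim/mpoly_ring_ind: p => [c|i|p q IHp IHq|p q IHp IHq].
- by rewrite !DpolyC ?linear0 addr0.
- rewrite !DX DpolyX -big_split /=; apply: eq_bigr => k _.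
  have -> : lie B A i k = (B *m A) i k - (A *m B) i k.
    by rewrite /lie mxE; congr (_ + _); rewrite mxE.
  by rewrite -scalerDl addrC subrK.
- by rewrite !linearD /= IHp IHq; ring.
- by rewrite !DpolyM !linearD /= !DpolyM IHp IHq; ring.
Qed.

Lemma Dpoly_nilpotent A k : iter k (mulmx A) 1%:M = 0 ->
  forall p, exists N, iter N (Dpoly A) p = 0.
Proof.
move=> Ak; elim/mpoly_ring_ind => [c|i|p q [N pN] [M qM]|p q [N pN] [M qM]].
- by exists 1%N; rewrite /= DpolyC.
- exists k.
  suff -> j : iter j (Dpoly A) 'X_i = \sum_l (iter j (mulmx A) 1%:M) i l *: 'X_l.
    by rewrite Ak big1 // => l _; rewrite mxE scale0r.
  have AC j' : iter j' (mulmx A) 1%:M *m A = A *m iter j' (mulmx A) 1%:M.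
    by elim: j' => [|j' IH]; [rewrite mul1mx mulmx1|rewrite /= -mulmxA IH].
  elim: j => [|j IH].
    rewrite (bigD1 i) //= big1 ?addr0 ?mxE ?eqxx ?scale1r // => l li.
    by rewrite mxE eq_sym (negPf li) scale0r.
  rewrite iterS IH linear_sum /= -AC.
  under eq_bigr => l _ do rewrite linearZ /= DpolyX scaler_sumr.
  rewrite exchange_big /=; apply: eq_bigr => l _.
  by rewrite mxE scaler_suml; apply: eq_bigr => l' _; rewrite scalerA.
- exists (maxn N M); rewrite iter_add.
  by rewrite (iter_eq0_leq (leq_maxl N M) pN) (iter_eq0_leq (leq_maxr N M) qM) addr0.
- exists (N + M)%N.
  (* Induction on N + M replaces the binomial expansion: one application to p q gives two products,
     in each of which one of the two exponents has dropped by one. *)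
  have [d] := ubnP (N + M); elim: d N M p q pN qM => // d IH [|N] [|M] p q pN qM dNM.
  + by rewrite -[p]/(iter 0 (Dpoly A) p) pN mul0r linear0.
  + by rewrite -[p]/(iter 0 (Dpoly A) p) pN mul0r linear0.
  + by rewrite -[q]/(iter 0 (Dpoly A) q) qM mulr0 linear0.
  rewrite addSn iterSr DpolyM iter_add (IH N M.+1) ?add0r -?iterSr //.
  by rewrite -addSnnS (IH N.+1 M) -?iterSr // addSnnS.
Qed.

End Derivation.

(** * The Euler field and homogeneity *)

Section Euler.
Variables (R : numFieldType) (n : nat).
Implicit Types (A : 'M[R]_n) (p : {mpoly R[n]}).

Lemma Dpoly1_coef p m : (Dpoly 1%:M p)@_m = (mdeg m)%:R * p@_m.
Proof.
have D1X k : Dpoly 1%:M 'X_[k] = (mdeg k)%:R *: 'X_[k] :> {mpoly R[n]}.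
  rewrite mpolyXE_id mdegE natr_sum.
  apply: Dpoly_eigen_prod => i; rewrite -[(k i)%:R]mul1r; apply: Dpoly_eigenX.
  rewrite DpolyX scale1r (bigD1 i) //= mxE eqxx big1 ?addr0 ?scale1r // => l li.
  by rewrite mxE eq_sym (negPf li) scale0r.
elim/mpolyind: p => [|c k p _ _ IH]; first by rewrite linear0 mcoeff0 mulr0.
rewrite linearD linearZ /= D1X !mcoeffD IH !mcoeffZ !mcoeffX mulrDr.
by case: eqP => [->|_]; rewrite ?mulr0 // mulr1 [in RHS]mulrC mulr1.
Qed.

(** [Dpoly 1%:M] multiplies each monomial by its degree. Homogeneity thus becomes an eigenvector
    condition, to which the rules for derivations apply. *)
Lemma dhomog_Euler d p : (p \is d.-homog) <-> Dpoly 1%:M p = d%:R *: p.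
Proof.
split=> [/dhomogP pd|E].
  apply/mpolyP => m; rewrite Dpoly1_coef mcoeffZ.
  by have [/pd ->//|/memN_msupp_eq0 ->] := boolP (m \in msupp p); rewrite !mulr0.
apply/dhomogP => m; rewrite mcoeff_msupp => pm.
move/mpolyP/(_ m): E; rewrite Dpoly1_coef mcoeffZ => /(mulIf pm)/eqP.
by rewrite eqr_nat => /eqP.
Qed.

(** The Euler field commutes with every linear field, since the identity matrix commutes with A. *)
Lemma Dpoly_dhomog A d p : p \is d.-homog -> Dpoly A p \is d.-homog.
Proof.
move=> /dhomog_Euler pd; apply/dhomog_Euler.
rewrite Dpoly_lie pd linearZ /= /lie mulmx1 mul1mx subrr.
by rewrite -(scale0r A) Dpoly_scale scale0r addr0.
Qed.

Lemma pihomog_Dpoly A d p : pihomog mdeg d (Dpoly A p) = Dpoly A (pihomog mdeg d p).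
Proof.
elim/mpolyind: p => [|c m p _ _ IH]; first by rewrite !linear0.
rewrite !linearD /= IH !linearZ /= pihomogX; congr (c *: _ + _).
have Xm : Dpoly A 'X_[m] \is (mdeg m).-homog by rewrite Dpoly_dhomog // dhomogX.
case: eqP => [<-|/eqP md]; first by rewrite pihomog_dE.
by rewrite linear0 (pihomog_ne0 md).
Qed.

End Euler.

(** * Polynomials in two independent blocks of variables *)

Section Join.
Variables (R : fieldType) (n m : nat).

Definition polyl (p : {mpoly R[n]}) : {mpoly R[n + m]} :=
  p \mPo [tuple 'X_(lshift m i) | i < n].
Definition polyr (q : {mpoly R[m]}) : {mpoly R[n + m]} :=
  q \mPo [tuple 'X_(rshift n i) | i < m].
(** The pure tensor of p and q, realised in the polynomial ring of both blocks. *)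
Definition pmul p q := polyl p * polyr q.

Lemma pmulDl p p' q : pmul (p + p') q = pmul p q + pmul p' q.
Proof. by rewrite /pmul /polyl linearD mulrDl. Qed.
Lemma pmulDr p q q' : pmul p (q + q') = pmul p q + pmul p q'.
Proof. by rewrite /pmul /polyr linearD mulrDr. Qed.
Lemma pmulZl c p q : pmul (c *: p) q = c *: pmul p q.
Proof. by rewrite /pmul /polyl linearZ scalerAl. Qed.
Lemma pmulZr c p q : pmul p (c *: q) = c *: pmul p q.
Proof. by rewrite /pmul /polyr linearZ scalerAr. Qed.
Lemma pmul0l q : pmul 0 q = 0.
Proof. by rewrite /pmul /polyl linear0 mul0r. Qed.
Lemma pmul0r p : pmul p 0 = 0.
Proof. by rewrite /pmul /polyr linear0 mulr0. Qed.

Lemma pmul_suml (I : Type) (r : seq I) (P : pred I) f q :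
  pmul (\sum_(i <- r | P i) f i) q = \sum_(i <- r | P i) pmul (f i) q.
Proof. exact: (big_morph (pmul^~ q) (fun p p' => pmulDl p p' q) (pmul0l q)). Qed.

Definition mjoin (k : 'X_{1..n}) (l : 'X_{1..m}) : 'X_{1..n + m} :=
  [multinom match split i with inl j => k j | inr j => l j end | i < n + m].

Lemma mjoinl k l i : mjoin k l (lshift m i) = k i.
Proof. by rewrite mnmE (unsplitK (inl i)). Qed.

Lemma mjoinr k l i : mjoin k l (rshift n i) = l i.
Proof. by rewrite mnmE (unsplitK (inr i)). Qed.

Lemma mjoin_eq k l k' l' : (mjoin k l == mjoin k' l') = (k == k') && (l == l').
Proof.
apply/eqP/andP => [E|[/eqP -> /eqP ->]//]; split; apply/eqP/mnmP => i.
  by rewrite -(mjoinl k l) E mjoinl.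
by rewrite -(mjoinr k l) E mjoinr.
Qed.

Lemma mjoin_surj (a : 'X_{1..n + m}) :
  a = mjoin [multinom a (lshift m i) | i < n] [multinom a (rshift n i) | i < m].
Proof.
by apply/mnmP => i; rewrite mnmE; case: splitP => j ij; rewrite mnmE; congr (a _);
  apply/val_inj.
Qed.

Lemma pmulXX k l : pmul 'X_[k] 'X_[l] = 'X_[mjoin k l].
Proof.
rewrite /pmul /polyl /polyr !comp_mpolyX [RHS]mpolyXE_id big_split_ord /=.
by congr (_ * _); apply: eq_bigr => i _; rewrite tnth_mktuple ?mjoinl ?mjoinr.
Qed.

Lemma mcoeff_pmul p q k l : (pmul p q)@_(mjoin k l) = p@_k * q@_l.
Proof.
elim/mpolyind: p => [|c a p _ _ IHp]; first by rewrite pmul0l !mcoeff0 mul0r.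
rewrite pmulDl !mcoeffD IHp mulrDl; congr (_ + _) => {p IHp}.
elim/mpolyind: q => [|d b q _ _ IHq]; first by rewrite pmul0r !mcoeff0 mulr0.
rewrite pmulDr !mcoeffD IHq mulrDr; congr (_ + _) => {q IHq}.
rewrite pmulZl pmulZr pmulXX !mcoeffZ !mcoeffX mjoin_eq.
by do 2!case: eqP => _ /=; rewrite ?mulr0 ?mul0r ?mulr1.
Qed.

Lemma pmul_expand (f : {mpoly R[n + m]}) :
  exists s : seq ({mpoly R[n]} * {mpoly R[m]}), f = \sum_(x <- s) pmul x.1 x.2.
Proof.
pose x (a : 'X_{1..n + m}) : {mpoly R[n]} * {mpoly R[m]} :=
  (f@_a *: 'X_[[multinom a (lshift m i) | i < n]], 'X_[[multinom a (rshift n i) | i < m]]).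
exists [seq x a | a <- msupp f]; rewrite big_map [LHS]mpolyE; apply: eq_bigr => a _.
by rewrite pmulZl pmulXX -mjoin_surj.
Qed.

(** Comparing coefficients at a fixed monomial of the second block turns the relation into a scalar
    relation among the [v t]. *)
Lemma pmul_independent (T : eqType) (P : pred T) (v : T -> {mpoly R[n]})
    (s : seq T) (g : T -> {mpoly R[m]}) :
  independent P v -> uniq s -> {in s, forall t, P t} ->
  \sum_(t <- s) pmul (v t) (g t) = 0 -> {in s, forall t, g t = 0}.
Proof.
move=> v_free us sP s0 t ts; apply/mpolyP => l; rewrite mcoeff0.
apply: (v_free s (fun t => (g t)@_l)) => //.
apply/mpolyP => k; move/mpolyP/(_ (mjoin k l)): s0.
rewrite !linear_sum !mcoeff0 /= => s0; rewrite -[RHS]s0.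
by apply: eq_bigr => u _; rewrite mcoeffZ mcoeff_pmul mulrC.
Qed.

(** The block diagonal field is a derivation that acts on the first block through A and on the
    second through B; both facts are checked on variables. *)
Lemma Dpoly_pmul (A : 'M[R]_n) (B : 'M[R]_m) p q :
  Dpoly (block_mx A 0 0 B) (pmul p q) = pmul (Dpoly A p) q + pmul p (Dpoly B q).
Proof.
set C := block_mx _ _ _ _; rewrite /pmul DpolyM; congr (_ * _ + _ * _).
  elim/mpoly_ring_ind: p => [c|i|p p' IHp IHq|p p' IHp IHq].
  - by rewrite /polyl comp_mpolyC !DpolyC linear0.
  - rewrite /polyl comp_mpolyXU -tnth_nth tnth_mktuple !DpolyX.
    rewrite linear_sum big_split_ord /= [X in _ + X]big1 ?addr0 => [|j _].
      by apply: eq_bigr => j _; rewrite block_mxEul linearZ /= comp_mpolyXU -tnth_nth tnth_mktuple.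
    by rewrite block_mxEur mxE scale0r.
  - by rewrite /polyl !linearD /= -/(polyl _) IHp IHq.
  - by rewrite /polyl rmorphM /= !DpolyM linearD /= !rmorphM /= -/(polyl _) IHp IHq.
elim/mpoly_ring_ind: q => [c|i|p' q IHp IHq|p' q IHp IHq].
- by rewrite /polyr comp_mpolyC !DpolyC linear0.
- rewrite /polyr comp_mpolyXU -tnth_nth tnth_mktuple !DpolyX.
  rewrite linear_sum big_split_ord /= [X in X + _]big1 ?add0r => [|j _].
    by apply: eq_bigr => j _; rewrite block_mxEdr linearZ /= comp_mpolyXU -tnth_nth tnth_mktuple.
  by rewrite block_mxEdl mxE scale0r.
- by rewrite /polyr !linearD /= -/(polyr _) IHp IHq.
- by rewrite /polyr rmorphM /= !DpolyM linearD /= !rmorphM /= -/(polyr _) IHp IHq.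
Qed.

End Join.

(** The identity matrix is block diagonal, so Euler eigenvalues add. *)
Lemma pmul_dhomog (R : numFieldType) n m d e (p : {mpoly R[n]}) (q : {mpoly R[m]}) :
  p \is d.-homog -> q \is e.-homog -> pmul p q \is (d + e).-homog.
Proof.
move=> /dhomog_Euler pd /dhomog_Euler qe; apply/dhomog_Euler.
by rewrite scalar_mx_block Dpoly_pmul pd qe pmulZl pmulZr -scalerDl natrD.
Qed.

(** * The kernel on the tensor product *)

Section Triad.
(* [A |-> Dpoly A] reverses Lie brackets, so [Dpoly Y] raises and [Dpoly X]
   lowers weights. *)
Variables (R : numFieldType) (n : nat) (X Y Z : 'M[R]_n).
Hypothesis triad : sl2_triad X Y Z.

Lemma triad_XY v : Dpoly Y (Dpoly X v) = Dpoly X (Dpoly Y v) + Dpoly Z v.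
Proof. by case: triad => XY _ _; rewrite Dpoly_lie XY. Qed.

Lemma triad_ZX v : Dpoly Z (Dpoly Y v) = Dpoly Y (Dpoly Z v) + 2 *: Dpoly Y v.
Proof.
case: triad => _ _ ZY; rewrite Dpoly_lie -Dpoly_scale; congr (_ + Dpoly _ _).
by rewrite /lie -opprB -/(lie Z Y) ZY opprK.
Qed.

Lemma triad_ZY v : Dpoly Z (Dpoly X v) = Dpoly X (Dpoly Z v) - 2 *: Dpoly X v.
Proof.
case: triad => _ ZX _; rewrite Dpoly_lie -scaleNr -Dpoly_scale; congr (_ + Dpoly _ _).
by rewrite /lie -opprB -/(lie Z X) ZX scaleNr.
Qed.

Lemma triad_nilpX v : exists N, iter N (Dpoly Y) v = 0.
Proof.
case: triad => _ _ ZY; have [||k Yk] := @lie_eigen_nilpotent _ _ Z Y (- 2).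
- by rewrite oppr_eq0 pnatr_eq0.
- by rewrite ZY scaleNr.
exact: Dpoly_nilpotent Yk v.
Qed.

Lemma triad_nilpY v : exists N, iter N (Dpoly X) v = 0.
Proof.
case: triad => _ ZX _; have [|k Xk] := lie_eigen_nilpotent _ ZX.
  by rewrite pnatr_eq0.
exact: Dpoly_nilpotent Xk v.
Qed.

End Triad.

Definition weight_basis (R : numFieldType) n (Y Z : 'M[R]_n) (K : eqType)
    (A : pred K) (a : K -> {mpoly R[n]}) (w : K -> nat) : Prop :=
  [/\ {in A, forall k, Dpoly Y (a k) = 0},
      {in A, forall k, Dpoly Z (a k) = (w k)%:R *: a k},
      independent A a
    & forall v, Dpoly Y v = 0 -> spanned A a v].

(** * Clebsch-Gordan decomposition of the invariants *)

Section ClebschGordan.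
Variables (R : numFieldType) (n m : nat).
Variables (X1 Y1 Z1 : 'M[R]_n) (X2 Y2 Z2 : 'M[R]_m).
Hypotheses (triad1 : sl2_triad X1 Y1 Z1) (triad2 : sl2_triad X2 Y2 Z2).
Local Notation D := (Dpoly (block_mx Y1 0 0 Y2)).

(* The coefficients are chosen so that [D (ker_lift a w h)] telescopes. *)
Definition lift_coef (w j : nat) : R := (-1) ^+ j / (j`! * w ^_ j)%:R.

(** Candidate for the invariant with leading term [pmul a h]; [Dpoly_ker_lift] gives the condition
    on h. *)
Definition ker_lift (a : {mpoly R[n]}) (w : nat) (h : {mpoly R[m]}) :=
  \sum_(j < w.+1) lift_coef w j *: pmul (iter j (Dpoly X1) a) (iter j (Dpoly Y2) h).

Lemma lift_coef0 w : lift_coef w 0 = 1.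
Proof. by rewrite /lift_coef expr0 ffactn0 fact0 muln1 divr1. Qed.

Lemma lift_coefS w j : (j < w)%N ->
  lift_coef w j.+1 * (j.+1%:R * (w%:R - j%:R)) = - lift_coef w j.
Proof.
move=> jw; rewrite /lift_coef factS ffactnSr -natrB ?(ltnW jw) //.
have w0 : (w ^_ j)%:R != 0 :> R by rewrite pnatr_eq0 -lt0n ffact_gt0 ltnW.
have j0 : (j`!)%:R != 0 :> R by rewrite pnatr_eq0 -lt0n fact_gt0.
have jj : j.+1%:R != 0 :> R by rewrite pnatr_eq0.
have wj : (w - j)%:R != 0 :> R by rewrite pnatr_eq0 subn_eq0 -ltnNge.
rewrite exprS !natrM; field.
by rewrite w0 j0 wj -natr1 in jj *; rewrite addrC jj.
Qed.

Lemma lift_coef_neq0 w j : (j <= w)%N -> lift_coef w j != 0.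
Proof.
move=> jw; rewrite /lift_coef mulf_neq0 ?invr_eq0 ?expf_neq0 ?oppr_eq0 ?oner_eq0 //.
by rewrite pnatr_eq0 -lt0n muln_gt0 fact_gt0 ffact_gt0.
Qed.

Fact ker_lift_is_linear a w : linear (ker_lift a w).
Proof.
move=> c h h'; rewrite /ker_lift scaler_sumr -big_split /=; apply: eq_bigr => j _.
by rewrite iter_add iterZ pmulDr pmulZr scalerDr !scalerA mulrC.
Qed.

HB.instance Definition _ a w := GRing.isLinear.Build R {mpoly R[m]} {mpoly R[n + m]} _
  (ker_lift a w) (ker_lift_is_linear a w).

(** The field on the second block keeps rung j, while the field on the first sends rung j+1 to rung
    j by [X_iterY]. *)
Lemma Dpoly_string a w (g : nat -> {mpoly R[m]}) :
  Dpoly Y1 a = 0 -> Dpoly Z1 a = w%:R *: a ->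
  D (\sum_(j < w.+1) pmul (iter j (Dpoly X1) a) (g j)) =
  \sum_(j < w.+1) pmul (iter j (Dpoly X1) a)
    (Dpoly Y2 (g j) + (j.+1%:R * (w%:R - j%:R)) *: g j.+1).
Proof.
move=> Ya Za; rewrite linear_sum /=.
under eq_bigr => j _ do rewrite Dpoly_pmul.
under [RHS]eq_bigr => j _ do rewrite pmulDr pmulZr.
rewrite !big_split /= addrC; congr (_ + _).
(* Rung 0 is killed by [Dpoly Y1]; the term j = w on the right, which mentions [g w.+1], has factor
   w - w = 0. *)
rewrite big_ord_recl /= Ya pmul0l add0r big_ord_recr /= subrr mulr0 scale0r addr0.
apply: eq_bigr => j _.
rewrite -/(iter j.+1 (Dpoly X1) a).
rewrite (X_iterY (triad_XY triad1) (triad_ZY triad1) Ya Za).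
by rewrite pmulZl.
Qed.

(** Below the top rung the two contributions cancel by [lift_coefS]; the top rung carries
    [iter w.+1 (Dpoly Y2) h]. *)
Lemma Dpoly_ker_lift a w h : Dpoly Y1 a = 0 -> Dpoly Z1 a = w%:R *: a ->
  iter w.+1 (Dpoly Y2) h = 0 -> D (ker_lift a w h) = 0.
Proof.
move=> Ya Za h0; rewrite /ker_lift.
under eq_bigr => j _ do rewrite -pmulZr.
rewrite (Dpoly_string (fun j => lift_coef w j *: iter j (Dpoly Y2) h)) //.
rewrite big1 // => -[j /= jw] _; rewrite linearZ /= scalerA mulrC -!iterS.
move: jw; rewrite ltnS leq_eqVlt => /predU1P[->|jw].
  by rewrite h0 !scaler0 addr0 pmul0r.
by rewrite lift_coefS // scaleNr subrr pmul0r.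
Qed.

Variables (K1 K2 : eqType) (A1 : pred K1) (A2 : pred K2).
Variables (a : K1 -> {mpoly R[n]}) (b : K2 -> {mpoly R[m]}).
Variables (w1 : K1 -> nat) (w2 : K2 -> nat).
Hypotheses (aP : weight_basis Y1 Z1 A1 a w1) (bP : weight_basis Y2 Z2 A2 b w2).

Local Notation ladder1 := (ladder (Dpoly X1) a).
Local Notation ladder2 := (ladder (Dpoly X2) b).
Local Notation dom1 := (ladder_dom A1 w1).
Local Notation dom2 := (ladder_dom A2 w2).

Lemma ladder1_independent : independent dom1 ladder1.
Proof.
case: aP => aX aZ a_free _.
exact: (ladder_independent (triad_XY triad1) (triad_ZY triad1) aX aZ a_free).
Qed.

Lemma ladder1_spanned v : spanned dom1 ladder1 v.
Proof.
case: aP => aX aZ a_free a_span.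
exact: (spanned_ladder (triad_XY triad1) (triad_ZX triad1) (triad_ZY triad1)
  aX aZ a_free a_span (triad_nilpY triad1) (triad_nilpX triad1)).
Qed.

Lemma ladder2_independent : independent dom2 ladder2.
Proof.
case: bP => bX bZ b_free _.
exact: (ladder_independent (triad_XY triad2) (triad_ZY triad2) bX bZ b_free).
Qed.

Lemma ladder2_spanned_ker N v : iter N (Dpoly Y2) v = 0 ->
  spanned (fun t => dom2 t && (t.2 < N)%N) ladder2 v.
Proof.
case: bP => bX bZ b_free b_span.
exact: (spanned_ker_iterX (triad_XY triad2) (triad_ZX triad2) (triad_ZY triad2)
  bX bZ b_free b_span (triad_nilpY triad2)).
Qed.

Definition ladder_seq (ks : seq K1) : seq (K1 * nat) :=
  [seq (k, j) | k <- ks, j <- index_iota 0 (w1 k).+1].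

Lemma mem_ladder_seq ks k j :
  ((k, j) \in ladder_seq ks) = (k \in ks) && (j <= w1 k)%N.
Proof.
apply/allpairsPdep/andP => [[k' [j' [ks' + [-> ->]]]]|[kks jw]].
  by rewrite mem_index_iota ltnS.
by exists k, j; rewrite mem_index_iota ltnS.
Qed.

Lemma ladder_seq_uniq ks : uniq ks -> uniq (ladder_seq ks).
Proof.
move=> us; apply: allpairs_uniq_dep => // [k _|]; first exact: iota_uniq.
by move=> [k j] [k' j'] _ _ /= [-> ->].
Qed.

Lemma ladder_seq_dom ks : {in ks, forall k, A1 k} -> {in ladder_seq ks, forall t, dom1 t}.
Proof. by move=> ksA [k j]; rewrite mem_ladder_seq => /andP[/ksA ? ?]; apply/andP. Qed.

Lemma sum_ladder_seq (V : nmodType) ks (f : K1 * nat -> V) :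
  \sum_(t <- ladder_seq ks) f t = \sum_(k <- ks) \sum_(j < (w1 k).+1) f (k, val j).
Proof. by rewrite big_allpairs_dep; apply: eq_bigr => k _; rewrite big_mkord. Qed.

(** Expansion along the ladder basis of the first block, padded with zeros to complete strings so
    that [Dpoly_string] applies. *)
Lemma string_expand (f : {mpoly R[n + m]}) :
  exists (ks : seq K1) (g : K1 -> nat -> {mpoly R[m]}),
    [/\ uniq ks, {in ks, forall k, A1 k}
      & f = \sum_(k <- ks) \sum_(j < (w1 k).+1)
              pmul (iter j (Dpoly X1) (a k)) (g k j)].
Proof.
suff [s [g [us sP fE]]] : expands (fun t => pmul (ladder1 t)) dom1 f.
  pose ks := undup [seq t.1 | t <- s].
  exists ks, (fun k j => if (k, j) \in s then g (k, j) else 0).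
  split; first exact: undup_uniq.
    by move=> k; rewrite mem_undup => /mapP[t /sP/andP[? _] ->].
  rewrite -(sum_ladder_seq ks (fun t => pmul (ladder1 t) (if t \in s then g t else 0))).
  rewrite fE; apply: (sum_widen (G := fun t => pmul (ladder1 t))) => [t|||] //.
  - exact: pmul0r.
  - exact/ladder_seq_uniq/undup_uniq.
  move=> [k j] ts; rewrite mem_ladder_seq; have /andP[_ ->] := sP _ ts.
  by rewrite andbT mem_undup; apply/mapP; exists (k, j).
have [l ->] := pmul_expand f; elim: l => [|[p q] l IH].
  by rewrite big_nil; apply: expands0.
rewrite big_cons; apply: expandsD IH => [t|t x y|]; [exact: pmul0r|exact: pmulDr|].
have [s [c [us sP pE]]] := ladder1_spanned p; exists s, (fun t => c t *: q); split=> //.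
by rewrite /= pE pmul_suml; apply: eq_bigr => t _; rewrite pmulZl pmulZr.
Qed.

Lemma string_independent ks (g : K1 -> nat -> {mpoly R[m]}) :
  uniq ks -> {in ks, forall k, A1 k} ->
  \sum_(k <- ks) \sum_(j < (w1 k).+1) pmul (iter j (Dpoly X1) (a k)) (g k j) = 0 ->
  forall k j, k \in ks -> (j <= w1 k)%N -> g k j = 0.
Proof.
move=> us ksA; rewrite -(sum_ladder_seq ks (fun t => pmul (ladder1 t) (g t.1 t.2))).
move=> /(pmul_independent ladder1_independent (ladder_seq_uniq us) (ladder_seq_dom ksA)).
by move=> s0 k j kks jw; apply: (s0 (k, j)); rewrite mem_ladder_seq kks.
Qed.

(** The falling factorial is the coefficient of the transvectant at j = 0, where the lift has
    coefficient 1. *)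
Definition tv_poly (t : K1 * K2 * nat) : {mpoly R[n + m]} :=
  (w1 t.1.1 ^_ t.2)%:R *: ker_lift (a t.1.1) (w1 t.1.1) (ladder2 (t.1.2, t.2)).

Definition tv_dom : pred (K1 * K2 * nat) := fun t =>
  [&& A1 t.1.1, A2 t.1.2, (t.2 <= w1 t.1.1)%N & (t.2 <= w2 t.1.2)%N].

Lemma tv_polyE t : tv_dom t -> let: (k, l, s) := t in
  tv_poly t = \sum_(j < s.+1)
    ((-1) ^+ j * 'C(s, j)%:R * ((w1 k - j)`!%:R / (w1 k - s)`!%:R)
       * ((w2 l - s + j)`!%:R / (w2 l - s)`!%:R))
    *: pmul (iter j (Dpoly X1) (a k)) (iter (s - j) (Dpoly X2) (b l)).
Proof.
case: t => [[k l] s] /and4P[/= Ak Al sk sl].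
case: bP => bX bZ _ _.
rewrite /tv_poly /ker_lift /ladder2 /ladder /= scaler_sumr.
(* The lift runs up to [w1 k], the transvectant only up to s; the terms with j > s vanish because
   [iter j (Dpoly Y2)] kills rung s. *)
rewrite (big_ord_widen_cond (w1 k).+1 predT (fun j =>
  ((-1) ^+ j * 'C(s, j)%:R * ((w1 k - j)`!%:R / (w1 k - s)`!%:R)
     * ((w2 l - s + j)`!%:R / (w2 l - s)`!%:R))
  *: pmul (iter j (Dpoly X1) (a k)) (iter (s - j) (Dpoly X2) (b l)))) ?ltnS //.
rewrite [RHS]big_mkcond /=; apply: eq_bigr => j _; rewrite ltnS; case: leqP => js; last first.
  rewrite (iterX_iterY0 (triad_XY triad2) (triad_ZY triad2) (bX _ Al) (bZ _ Al)) //.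
  by rewrite pmul0r !scaler0.
rewrite (iterX_iterY (triad_XY triad2) (triad_ZY triad2) (bX _ Al) (bZ _ Al)) //.
rewrite pmulZr !scalerA; congr (_ *: _); rewrite /lift_coef.
have f0 i : i`!%:R != 0 :> R by rewrite pnatr_eq0 -lt0n fact_gt0.
have E1 : (w1 k ^_ s)%:R = (w1 k)`!%:R / (w1 k - s)`!%:R :> R.
  by rewrite -(ffact_fact sk) natrM mulfK.
have jw : (j <= w1 k)%N := leq_trans js sk.
have E2 : (w1 k ^_ j)%:R = (w1 k)`!%:R / (w1 k - j)`!%:R :> R.
  by rewrite -(ffact_fact jw) natrM mulfK.
have E3 : ((w2 l - s + j) ^_ j)%:R = (w2 l - s + j)`!%:R / (w2 l - s)`!%:R :> R.
  by rewrite -(ffact_fact (leq_addl (w2 l - s) j)) addnK natrM mulfK.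
rewrite !natrM E3 E1 E2 -bin_ffact natrM; field.
by rewrite !f0.
Qed.

Lemma Dpoly_tv_poly t : tv_dom t -> D (tv_poly t) = 0.
Proof.
case: t => [[k l] s] /and4P[/= Ak Al sk sl].
case: aP => aX aZ _ _; case: bP => bX bZ _ _.
rewrite /tv_poly linearZ /= Dpoly_ker_lift ?scaler0 ?aX ?aZ //.
exact: (iterX_iterY0 (triad_XY triad2) (triad_ZY triad2) (bX _ Al) (bZ _ Al)).
Qed.

Lemma tv_poly_spanned f : D f = 0 -> spanned tv_dom tv_poly f.
Proof.
move=> Df; have [ks [g [us ksA fE]]] := string_expand f.
case: aP => aX aZ _ _.
(* Coefficients of [D f = 0] are compared rung by rung. *)
have gS k j : k \in ks -> (j <= w1 k)%N ->
    Dpoly Y2 (g k j) + (j.+1%:R * ((w1 k)%:R - j%:R)) *: g k j.+1 = 0.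
  move=> kks jw; move: k j kks jw.
  apply: (string_independent (g := fun k j => Dpoly Y2 (g k j)
    + (j.+1%:R * ((w1 k)%:R - j%:R)) *: g k j.+1)) => //.
  rewrite -[RHS]Df fE linear_sum big_seq [RHS]big_seq; apply: eq_bigr => k kks.
  exact/esym/(Dpoly_string (g k) (aX _ (ksA _ kks)) (aZ _ (ksA _ kks))).
(* Below the top rung the factor of the next coefficient is nonzero, so the recurrence determines
   every [g k j] from [g k 0]. *)
have gE k j : k \in ks -> (j <= w1 k)%N ->
    g k j = lift_coef (w1 k) j *: iter j (Dpoly Y2) (g k 0%N).
  move=> kks; elim: j => [|j IH] jw.
    by rewrite lift_coef0 scale1r.
  have := gS k j kks (ltnW jw); rewrite (IH (ltnW jw)) linearZ /= -iterS.
  have nz : j.+1%:R * ((w1 k)%:R - j%:R) != 0 :> R.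
    by rewrite mulf_neq0 ?pnatr_eq0 // subr_eq0 eqr_nat gtn_eqF.
  move/eqP; rewrite addrC addr_eq0 -scaleNr -lift_coefS // => /eqP E.
  by apply: (scalerI nz); rewrite E scalerA mulrC.
rewrite fE big_seq; apply: spanned_sum => k kks.
have -> : \sum_(j < (w1 k).+1) pmul (iter j (Dpoly X1) (a k)) (g k j) =
          ker_lift (a k) (w1 k) (g k 0%N).
  by apply: eq_bigr => -[j /= jw] _; rewrite gE // pmulZr.
(* At the top rung the next coefficient has factor zero, and the recurrence becomes a constraint on
   [g k 0]. *)
have g0 : iter (w1 k).+1 (Dpoly Y2) (g k 0%N) = 0.
  have := gS k _ kks (leqnn _); rewrite subrr mulr0 scale0r addr0 gE // linearZ /=.
  by move/eqP; rewrite scaler_eq0 (negPf (lift_coef_neq0 (leqnn _))) => /eqP.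
(* This kernel is spanned by the rungs s of the second ladder with s below [(w1 k).+1], which is the
   admissibility bound from the first block. *)
apply: spanned_trans (spanned_linear (ker_lift (a k) (w1 k)) (ladder2_spanned_ker g0)).
move=> [l s] /andP[/andP[/= Al sl] sk]; rewrite /comp.
have w0 : (w1 k ^_ s)%:R != 0 :> R by rewrite pnatr_eq0 -lt0n ffact_gt0.
rewrite -[ker_lift _ _ _]scale1r -(mulVf w0) -scalerA; apply: spannedZ.
apply: (@spanned_gen _ _ _ _ tv_poly (k, l, s)).
by apply/and4P; split=> //; apply: ksA.
Qed.

Lemma tv_poly_independent : independent tv_dom tv_poly.
Proof.
move=> s c us sP s0 t0 t0s.
pose ks := undup [seq t.1.1 | t <- s].
pose d t := c t * (w1 t.1.1 ^_ t.2)%:R.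
pose h k := \sum_(t <- s | t.1.1 == k) d t *: ladder2 (t.1.2, t.2).
have ksA : {in ks, forall k, A1 k}.
  by move=> k; rewrite mem_undup => /mapP[t /sP/and4P[? _ _ _] ->].
pose k0 := t0.1.1.
have k0s : k0 \in ks by rewrite mem_undup; apply/mapP; exists t0.
(* The relation is the sum over k of the lifts of [h k]; its rung 0 over k0, where the lift
   coefficient is 1, is [h k0]. *)
have hk0 : h k0 = 0.
  have := @string_independent ks
    (fun k j => lift_coef (w1 k) j *: iter j (Dpoly Y2) (h k)) (undup_uniq _) ksA.
  move=> /(_ _ k0 0%N k0s isT); rewrite lift_coef0 scale1r; apply.
  rewrite -[RHS]s0.
  transitivity (\sum_(k <- ks) \sum_(t <- s | t.1.1 == k) c t *: tv_poly t).
    apply: eq_bigr => k _.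
    transitivity (ker_lift (a k) (w1 k) (h k)).
      by apply: eq_bigr => j _; rewrite pmulZr.
    rewrite linear_sum; apply: eq_bigr => t /eqP tk.
    by rewrite linearZ /= /d /tv_poly tk scalerA.
  rewrite (exchange_big_dep predT) //= big_seq [RHS]big_seq; apply: eq_bigr => t ts.
  have tks : t.1.1 \in ks by rewrite mem_undup; apply/mapP; exists t.
  rewrite -big_filter (@eq_filter _ _ (pred1 t.1.1)) => [|k]; last by rewrite /= eq_sym.
  by rewrite filter_pred1_uniq ?undup_uniq // big_seq1.
have [Ak0 Al0 sk0 sl0] := and4P (sP _ t0s).
have w0 : (w1 k0 ^_ t0.2)%:R != 0 :> R by rewrite pnatr_eq0 -lt0n ffact_gt0.
(* With the first index fixed at k0 the pairs (l, s) remain distinct, so independence of the second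
   ladder applies. *)
pose u := [seq (t.1.2, t.2) | t <- s & t.1.1 == k0].
have uu : uniq u.
  rewrite map_inj_in_uniq ?filter_uniq // => -[[k l] j] [[k' l'] j'].
  by rewrite !mem_filter /= => /andP[/eqP -> _] /andP[/eqP -> _] [-> ->].
have uP : {in u, forall x, dom2 x}.
  move=> _ /mapP[t + ->]; rewrite mem_filter => /andP[_ /sP/and4P[_ ? _ ?]].
  by apply/andP.
have := @ladder2_independent u (fun x => d (k0, x.1, x.2)) uu uP.
have -> : \sum_(x <- u) d (k0, x.1, x.2) *: ladder2 x = 0.
  rewrite -[RHS]hk0 big_map big_filter; apply: eq_bigr => -[[k l] j] /= /eqP -> //.
move=> /(_ erefl (t0.1.2, t0.2)) /=.
rewrite -/k0 (_ : (k0, t0.1.2, t0.2) = t0); last by rewrite /k0; case: (t0) => [[]].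
move=> dt0; have /eqP : d t0 = 0.
  by apply: dt0; apply/mapP; exists t0 => //; rewrite mem_filter eqxx.
by rewrite mulf_eq0 (negPf w0) orbF => /eqP.
Qed.

End ClebschGordan.

(** * Formal power series *)

Section Graded.
Variables (R : fieldType) (n : nat).

Definition mono_fps (e : nat) (p : {mpoly R[n]}) : fps R n :=
  fun d => if d == e then p else 0.

Lemma fps_homogE (f : fps R n) e : fps_homog f e -> f = mono_fps e (f e).
Proof.
move=> [_ f0]; apply: funext => d; rewrite /mono_fps.
by case: eqP => [->//|/f0].
Qed.

Lemma fps_mul_mono d e p q :
  fps_mul (mono_fps d p) (mono_fps e q) = mono_fps (d + e) (p * q).
Proof.
apply: funext => k; rewrite /fps_mul /mono_fps.
have [dk|kd] := leqP d k; last first.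
  rewrite big1 ?ltn_eqF ?ltn_addr // => -[i /= ik] _.
  by rewrite ltn_eqF ?mul0r // (leq_ltn_trans _ kd).
rewrite (bigD1 (Ordinal (dk : (d < k.+1)%N))) //= big1 ?addr0 => [|i /eqP id].
  have -> : (k - d == e)%N = (k == d + e)%N by apply/eqP/eqP; lia.
  by rewrite eqxx; case: eqP; rewrite ?mulr0.
by case: eqP => [ie|_]; rewrite ?mul0r //; case: id; apply: val_inj.
Qed.

Lemma fps_monom_mono p (alpha : 'I_p -> fps R n) e P k :
  (forall i, alpha i = mono_fps (e i) (P i)) ->
  fps_monom alpha k = mono_fps (\sum_i e i * k i) (\prod_i P i ^+ k i).
Proof.
move=> aE; rewrite /fps_monom unlock /=.
elim: (index_enum _) => [|i r IH] //=.
rewrite {}IH -fps_mul_mono; congr fps_mul; rewrite /fps_exp.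
elim: (k i) => [|j IH] /=; first by rewrite muln0.
by rewrite IH aE fps_mul_mono mulnS exprS.
Qed.

Lemma iter_fpsD_mono j (A : 'M[R]_n) e p :
  iter j (fpsD A) (mono_fps e p) = mono_fps e (iter j (Dpoly A) p).
Proof.
elim: j => //= j ->; apply: funext => d; rewrite /fpsD /mono_fps.
by case: eqP; rewrite ?linear0.
Qed.

Lemma mono_fps_pihomog e p d : p \is e.-homog -> mono_fps e p d = pihomog mdeg d p.
Proof.
move=> pe; rewrite /mono_fps; case: eqP => [->|/eqP de]; first by rewrite pihomog_dE.
by rewrite (@pihomog_ne0 _ _ _ e) // eq_sym.
Qed.

Variables (T : eqType) (P : pred T) (F : T -> fps R n).
Variables (deg : T -> nat) (Q : T -> {mpoly R[n]}).
Hypothesis FE : {in P, forall t, F t = mono_fps (deg t) (Q t)}.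
Hypothesis Q_homog : {in P, forall t, Q t \is (deg t).-homog}.

(** A relation among homogeneous polynomials holds exactly when it holds in each degree. *)
Lemma independent_lin_indep : independent P Q <-> lin_indep P F.
Proof.
split=> H s c us sP s0; apply: H => //.
  set v := \sum_(t <- s) _; rewrite [v](pihomog_partitionE (leqnn (mmeasure mdeg v))).
  rewrite big1 // => d _; rewrite linear_sum -[RHS](s0 d) big_seq [RHS]big_seq.
  apply: eq_bigr => t ts; rewrite linearZ /=.
  by rewrite (FE (sP _ ts)) (mono_fps_pihomog _ (Q_homog (sP _ ts))).
move=> d; have := congr1 (pihomog mdeg d) s0; rewrite linear0 linear_sum => s0d.
rewrite -[RHS]s0d big_seq [RHS]big_seq; apply: eq_bigr => t ts; rewrite linearZ /=.
by rewrite (FE (sP _ ts)) (mono_fps_pihomog _ (Q_homog (sP _ ts))).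
Qed.

(** Projecting to degree d discards the terms of other degrees. *)
Lemma spanned_dhomog d f : f \is d.-homog -> spanned P Q f ->
  exists sc : seq T * (T -> R), [/\ uniq sc.1,
    {in sc.1, forall t, P t /\ deg t = d} & f = \sum_(t <- sc.1) sc.2 t *: Q t].
Proof.
move=> fd [s [c [us sP fE]]]; exists ([seq t <- s | deg t == d], c); split => /=.
- exact: filter_uniq.
- by move=> t; rewrite mem_filter => /andP[/eqP ? /sP].
rewrite -(pihomog_dE fd) fE linear_sum big_filter [RHS]big_mkcond [LHS]big_seq [RHS]big_seq.
apply: eq_bigr => t ts; rewrite linearZ /=.
rewrite -(mono_fps_pihomog _ (Q_homog (sP _ ts))) /mono_fps eq_sym.
by case: ifP => //; rewrite scaler0.
Qed.

Section Spanning.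
Variable f : fps R n.
Hypothesis f_fps : is_fps f.
Hypothesis f_span : forall d, spanned P Q (f d).

Lemma spanned_fps : exists (s : nat -> seq T) (c : T -> R),
  [/\ forall d, uniq (s d), forall d, {in s d, forall t, P t /\ deg t = d},
      forall t, t \notin s (deg t) -> c t = 0
    & forall d, f d = \sum_(t <- s d) c t *: Q t].
Proof.
have [sc scP] := choice (fun d => spanned_dhomog (f_fps d) (f_span d)).
(* Each t has a single degree, so coefficients chosen separately in each degree glue to one
   function; it is set to 0 off the chosen sequences. *)
exists (fun d => (sc d).1),
  (fun t => if t \in (sc (deg t)).1 then (sc (deg t)).2 t else 0).
split=> [d|d|t /negPf ->//|d]; case: (scP d) => // _ sP ->.
by rewrite big_seq [RHS]big_seq; apply: eq_bigr => t ts; have [_ ->] := sP _ ts; rewrite ts.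
Qed.

Lemma spanned_countable_lincomb : countable_lincomb P F f.
Proof.
have [s [c [us sP c0 fE]]] := spanned_fps; exists c; split=> [t|d].
  by move=> Pt; apply: c0; apply: contra Pt => /sP[].
exists (s d); split=> // [t|].
  have [ts|/c0 ->] := boolP (t \in s (deg t)); last by rewrite scale0r eqxx.
  have [Pt _] := sP _ _ ts; rewrite FE // /mono_fps.
  by have [->//|_] := eqVneq d (deg t); rewrite scaler0 eqxx.
rewrite fE big_seq [RHS]big_seq; apply: eq_bigr => t /sP[Pt dt].
by rewrite FE // /mono_fps dt eqxx.
Qed.

Lemma spanned_fin_lincomb : is_poly_fps f -> fin_lincomb P F f.
Proof.
move=> [N fN]; have [s [c [us sP _ fE]]] := spanned_fps.
exists (flatten [seq s d | d <- iota 0 N.+1]), c; split.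
  by move=> t /flatten_mapP[d _ /sP[]].
move=> d; rewrite big_flatten big_map.
(* The terms chosen for degree e contribute in that degree only. *)
have FsE e : \sum_(t <- s e) c t *: F t d = if d == e then f d else 0.
  case: eqP => [->|/eqP de].
    rewrite fE big_seq [RHS]big_seq; apply: eq_bigr => t /sP[Pt dt].
    by rewrite FE // /mono_fps dt eqxx.
  rewrite big_seq big1 // => t /sP[Pt dt].
  by rewrite FE // /mono_fps dt (negPf de) scaler0.
rewrite (eq_bigr _ (fun e _ => FsE e)) -big_mkcond.
rewrite -big_filter (@eq_filter _ _ (pred1 d)) => [|e]; last by rewrite /= eq_sym.
have [dN|Nd] := leqP d N.
  by rewrite filter_pred1_uniq ?iota_uniq ?mem_iota ?add0n ?ltnS // big_seq1.
rewrite fN // (_ : filter _ _ = [::]) ?big_nil //.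
by apply/eqP; rewrite -size_eq0 size_filter count_uniq_mem ?iota_uniq // mem_iota ltnNge Nd.
Qed.

End Spanning.
End Graded.

(** Homogeneous generators make every monomial a single homogeneous polynomial, so the hypotheses on
    series become statements about polynomials. *)
Lemma weight_basis_monom (R : numFieldType) n p (Y Z : 'M[R]_n)
    (alpha : 'I_p -> fps R n) (w : 'I_p -> nat) (A : pred {ffun 'I_p -> nat}) :
  hilbert_basis Y Z alpha w -> std_preferred_set Y alpha A ->
  exists (e : {ffun 'I_p -> nat} -> nat) (a : {ffun 'I_p -> nat} -> {mpoly R[n]}),
    [/\ forall k, fps_monom alpha k = mono_fps (e k) (a k),
        forall k, a k \is (e k).-homog & weight_basis Y Z A a (wdot w)].
Proof.
move=> [alpha_homog alpha_w _] [_ A_indep A_span _].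
have [e alpha_e] := fin_all_exists alpha_homog.
pose P i := alpha i (e i).
pose E (k : {ffun 'I_p -> nat}) := (\sum_i e i * k i)%N.
pose a (k : {ffun 'I_p -> nat}) := \prod_i P i ^+ k i.
have aE k : fps_monom alpha k = mono_fps (E k) (a k).
  by apply: fps_monom_mono => i; apply: fps_homogE.
(* One eigenvalue computation serves three fields: [Y] with x = 0, [Z] with the weights, and the
   Euler field with the degrees. *)
have a_eigen (B : 'M[R]_n) x k : (forall i, Dpoly B (P i) = (x i)%:R *: P i) ->
    Dpoly B (a k) = (\sum_i x i * k i)%N%:R *: a k.
  move=> PB; rewrite natr_sum; apply: Dpoly_eigen_prod => i.
  by rewrite natrM; apply: Dpoly_eigenX.
have a_homog k : a k \is (E k).-homog.
  by apply/dhomog_Euler/a_eigen => i; apply/dhomog_Euler; case: (alpha_e i) => /(_ (e i)).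
exists E, a; split=> //; split.
- move=> k _; rewrite (@a_eigen Y (fun=> 0%N)) => [|i].
    by rewrite big1 ?scale0r // => i; rewrite mul0n.
  by rewrite scale0r; case: (alpha_w i) => -[_ /(congr1 (fun f => f (e i)))].
- by move=> k _; apply: a_eigen => i; case: (alpha_w i) => _ /(congr1 (fun f => f (e i))).
- have FE : {in A, forall k, fps_monom alpha k = mono_fps (E k) (a k)} by [].
  by apply/(independent_lin_indep FE) => // k _; apply: a_homog.
(* The polynomial v is viewed as the series of its components; a countable combination is finite in
   each degree, and v has finitely many components. *)
move=> v Yv; pose f : fps R n := fun d => pihomog mdeg d v.
have /A_span[c [c0 cf]] : in_J Y f.
  split=> [d|]; first exact: pihomogP.
  by apply: funext => d; rewrite /fpsD /f -pihomog_Dpoly Yv linear0.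
rewrite [v](pihomog_partitionE (leqnn (mmeasure mdeg v))); apply: spanned_sum => d _.
rewrite -/(f d); have [s [_ _ ->]] := cf d; apply: spanned_sum => k _.
have [Ak|/c0 ->] := boolP (A k); last by rewrite scale0r; apply: spanned0.
rewrite aE /mono_fps; case: eqP => _; last by rewrite scaler0; apply: spanned0.
by apply/spannedZ/spanned_gen.
Qed.

Lemma transvectant_mono (R : fieldType) n m (X1 : 'M[R]_n) (X2 : 'M[R]_m)
    d e p q wf wg s :
  transvectant X1 X2 (mono_fps d p) (mono_fps e q) wf wg s =
  mono_fps (d + e) (\sum_(j < s.+1)
    ((-1) ^+ j * 'C(s, j)%:R * ((wf - j)`!%:R / (wf - s)`!%:R)
       * ((wg - s + j)`!%:R / (wg - s)`!%:R))
    *: pmul (iter j (Dpoly X1) p) (iter (s - j) (Dpoly X2) q)).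
Proof.
have emblE k r : embl m (mono_fps k r) = mono_fps k (polyl m r).
  by apply: funext => i; rewrite /embl /mono_fps; case: ifP; rewrite ?linear0.
have embrE k r : embr n (mono_fps k r) = mono_fps k (polyr n r).
  by apply: funext => i; rewrite /embr /mono_fps; case: ifP; rewrite ?linear0.
apply: funext => i; rewrite /transvectant.
under eq_bigr => j _ do rewrite !iter_fpsD_mono emblE embrE fps_mul_mono.
rewrite /mono_fps; case: ifP => // _.
by rewrite big1 // => j _; rewrite scaler0.
Qed.

Theorem theorem8p4 (R : realType) (n m p q : nat)
  (X1 Y1 Z1 : 'M[R]_n) (X2 Y2 Z2 : 'M[R]_m)
  (alpha : 'I_p -> fps R n) (wa : 'I_p -> nat)
  (beta : 'I_q -> fps R m) (wb : 'I_q -> nat)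
  (A1 : pred {ffun 'I_p -> nat}) (A2 : pred {ffun 'I_q -> nat}) :
  sl2_triad X1 Y1 Z1 -> sl2_triad X2 Y2 Z2 ->
  hilbert_basis Y1 Z1 alpha wa -> hilbert_basis Y2 Z2 beta wb ->
  std_preferred_set Y1 alpha A1 -> std_preferred_set Y2 beta A2 ->
  let Y := block_mx Y1 0 0 Y2 in
  let adm := admissible wa wb A1 A2 in
  let F := tv X1 X2 alpha wa beta wb in
  [/\ (forall t, adm t -> in_J Y (F t) /\ is_poly_fps (F t)),
      lin_indep adm F,
      (forall f, in_J Y f -> is_poly_fps f -> fin_lincomb adm F f)
    & (forall f, in_J Y f -> countable_lincomb adm F f)].
Proof.
move=> triad1 triad2 H1 H2 P1 P2 Y adm F.
have [e1 [a [aE a_homog aP]]] := weight_basis_monom H1 P1.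
have [e2 [b [bE b_homog bP]]] := weight_basis_monom H2 P2.
pose T := tv_poly X1 X2 Y2 a b (wdot wa).
pose deg (t : tv_index p q) := (e1 t.1.1 + e2 t.1.2)%N.
have FE : {in adm, forall t, F t = mono_fps (deg t) (T t)}.
  move=> [[k l] s] At; have := tv_polyE X1 triad2 a bP At; rewrite -/T => tE; rewrite tE.
  by rewrite /F /tv aE bE transvectant_mono.
have T_homog : {in adm, forall t, T t \is (deg t).-homog}.
  move=> [[k l] s] At; have := tv_polyE X1 triad2 a bP At; rewrite -/T => tE; rewrite tE /deg /=.
  apply: rpred_sum => j _; apply: rpredZ; apply: pmul_dhomog.
    by elim: (val j) => [|i IH] /=; [apply: a_homog|apply: Dpoly_dhomog].
  by elim: (s - j)%N => [|i IH] /=; [apply: b_homog|apply: Dpoly_dhomog].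
(* The kernel condition on a series holds degree by degree, so the polynomial result applies to each
   component. *)
have f_span f : in_J Y f -> forall d, spanned adm T (f d).
  move=> [_ fY] d; apply: (tv_poly_spanned triad1 triad2 aP bP).
  exact: (congr1 (fun f => f d) fY).
split.
- move=> t At; rewrite FE //; split; last first.
    by exists (deg t) => d dt; rewrite /mono_fps gtn_eqF.
  split=> [d|]; first by rewrite mono_fps_pihomog ?T_homog // pihomogP.
  apply: funext => d; rewrite /fpsD /mono_fps; case: eqP => _; last by rewrite linear0.
  exact: (Dpoly_tv_poly triad1 triad2 aP bP At).
- by apply/(independent_lin_indep FE T_homog)/(tv_poly_independent triad1 triad2 aP bP).
- by move=> f fJ; apply: (spanned_fin_lincomb FE T_homog); [case: fJ|apply: f_span].
- by move=> f fJ; apply: (spanned_countable_lincomb FE T_homog); [case: fJ|apply: f_span].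
Qed.
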